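(* For the dynamical system $(\mathcal{H},T)$, we have $\omega_{\widetilde{0}}\,\mathcal{C}(\mathcal{H})=\mathcal{W}$.
   Context: $\mathbb{N}=\{1,2,\ldots\}$, $\mathbb{Z}_+=\{0,1,2,\ldots\}$; $\mathbb{T}$ is the unit circle in $\mathbb{C}$, a group under multiplication; $\mathbb{T}_Q=\{e^{i2\pi q}:q\in\mathbb{Q}\}$. $H(\mathbb{T})$ is the set of all (not necessarily continuous) group homomorphisms $\mathbb{T}\to\mathbb{T}$, with pointwise multiplication and the topology of pointwise convergence. For $n\in\mathbb{Z}$, $n^\times\in H(\mathbb{T})$ is $x\mapsto x^n$. $\phi^{(j)}$ denotes the $j$-fold composition of $\phi$ with itself. The integers $s(k,j)$ are the (signed) Stirling numbers of the first kind: $n(n-1)\cdots(n-k+1)=\sum_{j=0}^k s(k,j)n^j$. $\mathcal{H}$ is the set of all $(\phi_k)_{k=0}^\infty\in H(\mathbb{T})^{\mathbb{Z}_+}$ with $\phi_0=1^\times=\mathrm{id}_{\mathbb{T}}$ and $\phi_k(x^{k!})=\prod_{j=1}^k\phi_1^{(j)}(x^{s(k,j)})$ for all $x\in\mathbb{T}_Q$, $k\in\mathbb{N}$, a compact space in the subspace topology of the product. $T:\mathcal{H}\to\mathcal{H}$ is the homeomorphism $T(\phi_0,\phi_1,\phi_2,\ldots)=(\phi_0,\phi_0\phi_1,\phi_1\phi_2,\ldots)$. $\widetilde{0}=(1^\times,0^\times,0^\times,\ldots)\in\mathcal{H}$. $\mathcal{C}(X)$ is the algebra of continuous complex-valued functions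 on a compact space $X$. For a dynamical system $(X,s)$ ($X$ compact Hausdorff, $s$ a homeomorphism) and $x\in X$, $\omega_x:\mathcal{C}(X)\to l^\infty(\mathbb{Z})$ is $\omega_x(f)(n)=f(s^nx)$. $\mathcal{W}$ (the Weyl algebra) is the smallest closed linear subspace of $l^\infty(\mathbb{Z})$ containing all functions $n\mapsto e^{i2\pi p(n)}$, $p:\mathbb{Z}\to\mathbb{R}$ a polynomial (with real coefficients). *)

(* Defs.v *)
From HB Require Import structures.
From mathcomp Require Import all_boot all_order all_algebra complex.
From mathcomp Require Import all_classical all_reals all_analysis.

Set Implicit Arguments.
Unset Strict Implicit.
Unset Printing Implicit Defensive.

Import Order.TTheory GRing.Theory Num.Theory.
Import numFieldNormedType.Exports.

Local Open Scope classical_set_scope.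
Local Open Scope ring_scope.
Local Open Scope complex_scope.

Definition expi (R : realType) (t : R) : R[i]^o := cos t +i* sin t.

Definition circle (R : realType) : Type := set_type [set z : R[i]^o | `|z| = 1].

HB.instance Definition _ (R : realType) :=
  Topological.copy (circle R) (set_type [set z : R[i]^o | `|z| = 1]).

Section CircleGroup.
Variable R : realType.
Implicit Types x y z : circle R.

Definition cval x : R[i]^o := val x.
Definition mkcircle (z : R[i]^o) (hz : `|z| = 1) : circle R :=
  SigSub (@mem_set _ [set z : R[i]^o | `|z| = 1] z hz).

Lemma cvalP x : `|cval x| = 1. Proof. exact: set_valP x. Qed.
Lemma cval_inj : injective cval. Proof. exact: val_inj. Qed.
Lemma cval_neq0 x : cval x != 0.
Proof. by rewrite -normr_eq0 cvalP oner_neq0. Qed.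

Let norm1 : `|1 : R[i]^o| = 1. Proof. exact: normr1. Qed.
Let normM x y : `|cval x * cval y : R[i]^o| = 1.
Proof. by rewrite normrM !cvalP mulr1. Qed.
Let normV x : `|(cval x)^-1 : R[i]^o| = 1.
Proof. by rewrite normfV cvalP invr1. Qed.

Definition circle_one : circle R := mkcircle norm1.
Definition circle_mul x y : circle R := mkcircle (normM x y).
Definition circle_inv x : circle R := mkcircle (normV x).

Lemma circle_mulA : associative circle_mul.
Proof. by move=> x y z; apply: cval_inj; exact: mulrA. Qed.
Lemma circle_mul1g : left_id circle_one circle_mul.
Proof. by move=> x; apply: cval_inj; exact: mul1r. Qed.
Lemma circle_mulg1 : right_id circle_one circle_mul.
Proof. by move=> x; apply: cval_inj; exact: mulr1. Qed.
Lemma circle_mulVg : left_inverse circle_one circle_inv circle_mul.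
Proof. by move=> x; apply: cval_inj; apply: mulVf; exact: cval_neq0. Qed.
Lemma circle_mulgV : right_inverse circle_one circle_inv circle_mul.
Proof. by move=> x; apply: cval_inj; apply: divff; exact: cval_neq0. Qed.

HB.instance Definition _ := isGroup.Build (circle R)
  circle_mulA circle_mul1g circle_mulg1 circle_mulVg circle_mulgV.

Lemma cvalM x y : cval (x * y)%g = cval x * cval y. Proof. by []. Qed.
Lemma cval1 : cval 1%g = 1. Proof. by []. Qed.
Lemma cvalV x : cval x^-1%g = (cval x)^-1. Proof. by []. Qed.
Lemma cvalX x n : cval (x ^+ n)%g = cval x ^+ n.
Proof. by elim: n => [|n IH] //; rewrite monoid.expgS cvalM IH exprS. Qed.

Lemma circle_mulC x y : (x * y)%g = (y * x)%g.
Proof. by apply: cval_inj; rewrite !cvalM mulrC. Qed.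

End CircleGroup.

Definition zexpg (G : groupType) (x : G) (m : int) : G :=
  match m with Posz n => (x ^+ n)%g | Negz n => (x ^- n.+1)%g end.

Definition Hom (R : realType) : Type :=
  set_type [set f : {ptws circle R -> circle R} |
    {morph f : x y / (x * y)%g}].

HB.instance Definition _ (R : realType) :=
  Topological.copy (Hom R)
    (set_type [set f : {ptws circle R -> circle R} |
      {morph f : x y / (x * y)%g}]).

Section Homs.
Variable R : realType.
Implicit Types (x y : circle R) (f g : Hom R).

Definition hom_fun f : circle R -> circle R := val f.
Coercion hom_fun : Hom >-> Funclass.

Definition mkhom (f : circle R -> circle R) (hf : {morph f : x y / (x * y)%g})
    : Hom R :=
  SigSub (@mem_set _ [set f : {ptws circle R -> circle R} |
    {morph f : x y / (x * y)%g}] f hf).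

Lemma homM f : {morph f : x y / (x * y)%g}. Proof. exact: set_valP f. Qed.
Lemma hom_ext f g : f =1 g -> f = g.
Proof. by move=> fg; apply: val_inj; apply/funext. Qed.

Lemma cval_zexpg x m : cval (zexpg x m) = (cval x : R[i]) ^ m.
Proof. by case: m => n; rewrite /= ?cvalV cvalX. Qed.

Let zexpgM m : {morph (fun x => zexpg x m) : x y / (x * y)%g}.
Proof.
by move=> x y; apply: cval_inj; rewrite cvalM !cval_zexpg cvalM exprzMl //;
   rewrite unitfE cval_neq0.
Qed.
Let hom_mulM f g : {morph (fun x => f x * g x)%g : x y / (x * y)%g}.
Proof.
by move=> x y; apply: cval_inj; rewrite !homM !cvalM mulrACA.
Qed.
Let hom_invM f : {morph (fun x => (f x)^-1)%g : x y / (x * y)%g}.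
Proof. by move=> x y; apply: cval_inj; rewrite homM cvalM !cvalV cvalM invfM. Qed.

Definition hom_pow (n : int) : Hom R := mkhom (@zexpgM n).
Definition hom_mul f g : Hom R := mkhom (@hom_mulM f g).
Definition hom_inv f : Hom R := mkhom (@hom_invM f).

End Homs.

Definition falling (k : nat) : {poly int} := \prod_(i < k) ('X - i%:R%:P).

(* Signed Stirling numbers of the first kind. *)
Definition stirling1 (k j : nat) : int := (falling k)`_j.

Definition circleQ (R : realType) : set (circle R) :=
  [set x | exists q : rat, cval x = expi (2 * pi * ratr q)].

(* For f = phi 1 this says phi k (x ^+ k!) = (f (f - 1) ... (f - k + 1)) x in the
   endomorphism ring of the (multiplicatively written) circle. *)
Definition calH_set (R : realType) : set {ptws nat -> Hom R} :=
  [set phi | phi 0%N = hom_pow R 1 /\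
    forall (x : circle R) (k : nat), circleQ x -> (0 < k)%N ->
      phi k (x ^+ k`!)%g =
      (\prod_(1 <= j < k.+1) iter j (phi 1%N) (zexpg x (stirling1 k j)))%g].

Definition calH (R : realType) : Type := set_type (@calH_set R).

HB.instance Definition _ (R : realType) :=
  Topological.copy (calH R) (set_type (@calH_set R)).

Definition seqT (R : realType) (phi : nat -> Hom R) : nat -> Hom R :=
  fun k => if k is k'.+1 then hom_mul (phi k') (phi k) else phi 0%N.

Fixpoint seqTinv (R : realType) (phi : nat -> Hom R) (k : nat) : Hom R :=
  if k is k'.+1 then hom_mul (hom_inv (seqTinv phi k')) (phi k) else phi 0%N.

Section Invariance.
Variable R : realType.
Implicit Types (x y : circle R) (f g : Hom R) (p q : {poly int}).

Lemma homX f x n : f (x ^+ n)%g = (f x ^+ n)%g.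
Proof.
have f1 : f 1%g = 1%g.
  by apply: (@monoid.mulgI _ (f 1%g)); rewrite -homM !monoid.mulg1.
by elim: n => [|n IH]; rewrite ?monoid.expgS ?homM ?IH.
Qed.

(* act f p is p(f), with f in the endomorphism ring of the circle. *)
Definition act_upto (N : nat) f p x : circle R :=
  (\prod_(0 <= j < N) iter j f (zexpg x p`_j))%g.
Definition act f p x := act_upto (size p) f p x.

Let iter1 f j : iter j f 1%g = 1%g.
Proof. by elim: j => //= j ->; exact: (homX f 1%g 0). Qed.

Let iterM f j : {morph iter j f : x y / (x * y)%g}.
Proof. by elim: j => //= j IH x y; rewrite /= IH homM. Qed.

Lemma act_uptoE N f p x : (size p <= N)%N -> act_upto N f p x = act f p x.
Proof.
move=> pN; rewrite /act /act_upto (big_cat_nat (leq0n _) pN) /=.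
rewrite [X in (_ * X)%g]big_nat_cond [X in (_ * X)%g]big1 ?monoid.mulg1 //.
by move=> j /andP[/andP[pj _] _]; rewrite nth_default //= iter1.
Qed.

Lemma zexpgD x m n : zexpg x (m + n) = (zexpg x m * zexpg x n)%g.
Proof.
apply: cval_inj; rewrite cvalM !cval_zexpg expfzDr //; exact: cval_neq0.
Qed.

Lemma actD f p q x : act f (p + q) x = (act f p x * act f q x)%g.
Proof.
pose N := maxn (size p) (size q).
rewrite -!(@act_uptoE N) ?leq_maxl ?leq_maxr ?size_polyD //.
rewrite /act_upto; elim: N => [|N IH]; first by rewrite !big_geq ?monoid.mulg1.
rewrite !big_nat_recr //= IH coefD zexpgD iterM.
rewrite -!monoid.mulgA; congr (_ * _)%g.
by rewrite !monoid.mulgA; congr (_ * _)%g; rewrite circle_mulC.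
Qed.

Lemma actXaddC f p c x :
  act f (p * 'X + c%:P) x = (zexpg x c * f (act f p x))%g.
Proof.
have sp : (size (p * 'X + c%:P)%R <= (size p).+1)%N.
  by rewrite size_MXaddC; case: ifP.
rewrite -(act_uptoE _ _ sp) /act /act_upto big_nat_recl // coefD coefMX coefC /=.
rewrite add0r; congr (_ * _)%g.
elim: (size p) => [|N IH]; first by rewrite !big_geq //; rewrite (homX f 1%g 0).
by rewrite !big_nat_recr //= homM IH coefD coefMX coefC /= addr0.
Qed.

Lemma act0 f x : act f 0 x = 1%g.
Proof. by rewrite /act /act_upto size_poly0 big_geq. Qed.

Lemma actC f c x : act f c%:P x = zexpg x c.
Proof.
have -> : c%:P = 0 * 'X + c%:P :> {poly int} by rewrite mul0r add0r.
by rewrite actXaddC act0 (homX f 1%g 0) monoid.mulg1.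
Qed.

Lemma act_shift f g p x : (forall y, g y = (y * f y)%g) ->
  act g p x = act f (p \Po ('X + 1)) x.
Proof.
move=> gE; elim/poly_ind: p => [|p c IH]; first by rewrite comp_poly0 !act0.
rewrite actXaddC IH gE comp_polyD comp_polyM comp_polyX comp_polyC mulrDr mulr1.
by rewrite addrAC actD actXaddC -monoid.mulgA; congr (_ * _)%g; exact: circle_mulC.
Qed.

Lemma act_scale f p n x : act f (n%:R *: p) x = act f p (x ^+ n)%g.
Proof.
rewrite -(@act_uptoE (size p)) ?size_scale_leq // /act /act_upto.
apply: eq_bigr => j _; congr (iter _ _ _); apply: cval_inj.
by rewrite !cval_zexpg coefZ cvalX exprnP exprz_exp natz.
Qed.

Lemma falling_recr k : falling k.+1 = falling k * ('X - k%:R%:P).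
Proof. exact: big_ord_recr. Qed.

Lemma falling_shift k :
  falling k.+1 \Po ('X + 1) = falling k.+1 + k.+1%:R *: falling k.
Proof.
have -> : falling k.+1 \Po ('X + 1) = falling k * ('X + 1).
  rewrite /falling big_ord_recl rmorphM /= rmorph_prod /= mulrC.
  rewrite comp_polyB comp_polyX comp_polyC subr0; congr (_ * _).
  apply: eq_bigr => i _; rewrite comp_polyB comp_polyX comp_polyC /=.
  by rewrite /bump leq0n add1n -natr1 polyCD opprD addrACA subrr addr0.
rewrite falling_recr -mul_polyC (mulrC _%:P) -mulrDr; congr (_ * _).
by rewrite -natr1 polyCD addrA subrK.
Qed.

Lemma size_falling k : size (falling k) = k.+1.
Proof.
elim: k => [|k IH]; first by rewrite /falling big_ord0 size_poly1.
by rewrite falling_recr size_Mmonic ?monicXsubC -?size_poly_gt0 ?IH // size_XsubC addn2.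
Qed.

Lemma falling_coef0 k : (0 < k)%N -> (falling k)`_0 = 0.
Proof.
case: k => // k _; rewrite -horner_coef0 /falling big_ord_recl hornerM.
by rewrite hornerXsubC sub0r oppr0 mul0r.
Qed.

Lemma calH_setE (phi : nat -> Hom R) :
  calH_set phi <-> phi 0%N = hom_pow R 1 /\
    forall x k, circleQ x -> phi k (x ^+ k`!)%g = act (phi 1%N) (falling k) x.
Proof.
have E k x : (0 < k)%N ->
    act (phi 1%N) (falling k) x =
    (\prod_(1 <= j < k.+1) iter j (phi 1%N) (zexpg x (stirling1 k j)))%g.
  move=> k0; rewrite /act /act_upto size_falling big_ltn // falling_coef0 //.
  exact: monoid.mul1g.
split=> -[phi0 phiP]; split=> // x k Qx.
  have [->|k0] := posnP k; last by rewrite E // phiP.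
  by rewrite phi0 /falling big_ord0 -polyC1 actC.
by move=> k0; rewrite phiP // E.
Qed.

Lemma circleQX x n : circleQ x -> circleQ (x ^+ n)%g.
Proof.
move=> [q xq]; exists (n%:R * q); rewrite cvalX xq.
elim: n => [|n IH]; first by rewrite mul0r rmorph0 mulr0 /expi cos0 sin0 expr0.
have -> : ratr (n.+1%:R * q) = ratr q + ratr (n%:R * q) :> R.
  by rewrite -natr1 mulrDl mul1r rmorphD addrC.
rewrite exprS IH [in RHS]mulrDr; set a := _ * ratr q; set b := _ * ratr _.
rewrite /expi cosD sinD.
by apply/eqP; rewrite eq_complex /=; apply/andP; split; apply/eqP;
  rewrite // addrC.
Qed.

Lemma act_falling_shift f g k x : (forall y, g y = (y * f y)%g) ->
  act g (falling k.+1) x =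
  (act f (falling k) (x ^+ k.+1) * act f (falling k.+1) x)%g.
Proof.
by move=> gE; rewrite (act_shift _ _ gE) falling_shift actD act_scale circle_mulC.
Qed.

Lemma exp_fact x k : (x ^+ k.+1`! = (x ^+ k.+1) ^+ k`!)%g.
Proof. by rewrite factS monoid.expgnA. Qed.

Lemma seqT_calH (phi : nat -> Hom R) : calH_set phi -> calH_set (seqT phi).
Proof.
move=> /calH_setE[phi0 phiP]; apply/calH_setE; split=> // x [|k] Qx.
  by rewrite phiP // /falling big_ord0 -polyC1 !actC.
have gE y : seqT phi 1%N y = (y * phi 1%N y)%g by rewrite /= phi0.
rewrite (act_falling_shift _ _ gE) -!phiP //; last exact: circleQX.
by rewrite -exp_fact.
Qed.

Lemma seqTinv_calH (phi : nat -> Hom R) : calH_set phi -> calH_set (seqTinv phi).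
Proof.
move=> /calH_setE[phi0 phiP]; apply/calH_setE; split=> // x k.
have gE y : phi 1%N y = (y * seqTinv phi 1%N y)%g.
  by rewrite /= phi0; exact/esym/(monoid.mulVKg y).
elim: k x => [|k IH] x Qx.
  by rewrite phiP // /falling big_ord0 -polyC1 !actC.
have := phiP _ k.+1 Qx; rewrite (act_falling_shift _ _ gE) -IH; last exact: circleQX.
by rewrite -exp_fact => /esym/(canRL (monoid.mulKg _)) ->.
Qed.

Lemma seqTK : cancel (@seqT R) (@seqTinv R).
Proof.
move=> phi; apply/funext; elim=> [//|k IH] /=; rewrite IH.
by apply: hom_ext => x; exact: monoid.mulKg.
Qed.

Lemma seqTinvK : cancel (@seqTinv R) (@seqT R).
Proof.
move=> phi; apply/funext => -[//|k] /=.
by apply: hom_ext => x; exact: monoid.mulVKg.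
Qed.

Lemma zero_seq_calH :
  calH_set (fun k => if k is 0%N then hom_pow R 1 else hom_pow R 0).
Proof.
split=> // x [//|k] Qx _; rewrite big_nat big1 ?[LHS]/= //.
by move=> [//|j] _.
Qed.

End Invariance.

Definition calH_seq (R : realType) (phi : calH R) : {ptws nat -> Hom R} := val phi.

Definition mkcalH (R : realType) (phi : nat -> Hom R) (h : calH_set phi) : calH R :=
  SigSub (@mem_set _ (@calH_set R) phi h).

Lemma calHP (R : realType) (phi : calH R) : calH_set (calH_seq phi).
Proof. exact: set_valP phi. Qed.

Definition calT (R : realType) (phi : calH R) : calH R :=
  mkcalH (seqT_calH (calHP phi)).

Definition calTinv (R : realType) (phi : calH R) : calH R :=
  mkcalH (seqTinv_calH (calHP phi)).

Lemma calTK (R : realType) : cancel (@calT R) (@calTinv R).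
Proof. by move=> phi; apply: val_inj; exact: seqTK. Qed.

Lemma calTinvK (R : realType) : cancel (@calTinv R) (@calT R).
Proof. by move=> phi; apply: val_inj; exact: seqTinvK. Qed.

Definition zero_tilde (R : realType) : calH R := mkcalH (zero_seq_calH R).

Section Continuity.
Variables (R : realType) (X : topologicalType).

Lemma continuous_circleP (h : X -> circle R) :
  continuous h <-> continuous (fun a => cval (h a)).
Proof.
split=> [ch a|]; last exact: continuous_comp_initial.
by apply: continuous_comp (ch a) _; exact: initial_continuous.
Qed.

Lemma continuous_ptwsP (I : choiceType) (Y : topologicalType)
    (h : X -> {ptws I -> Y}) :
  continuous h <-> forall i, continuous (fun a => h a i).
Proof.
split=> [ch i a|ch a].
  exact: (continuous_comp (ch a) (@proj_continuous _ (fun _ : I => Y) i _)).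
apply/cvg_sup => i; move: a.
exact: (@continuous_comp_initial {ptws I -> Y} X Y (@proj I (fun=> Y) i) h (ch i)).
Qed.

Lemma continuous_HomP (h : X -> Hom R) :
  continuous h <-> forall x, continuous (fun a => h a x).
Proof.
rewrite -(@continuous_ptwsP (circle R) _ (fun a => hom_fun (h a))).
split=> [ch a|]; last exact: continuous_comp_initial.
by apply: continuous_comp (ch a) _; exact: initial_continuous.
Qed.

Lemma continuous_calHP (h : X -> calH R) :
  continuous h <-> forall k, continuous (fun a => calH_seq (h a) k).
Proof.
rewrite -(@continuous_ptwsP nat _ (fun a => calH_seq (h a))).
split=> [ch a|]; last exact: continuous_comp_initial.
by apply: continuous_comp (ch a) _; exact: initial_continuous.
Qed.

Lemma continuous_hom_mul (f g : X -> Hom R) : continuous f -> continuous g ->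
  continuous (fun a => hom_mul (f a) (g a)).
Proof.
move=> /continuous_HomP cf /continuous_HomP cg.
apply/continuous_HomP => x; apply/continuous_circleP => a.
by apply: cvgM; [move: a; apply/continuous_circleP|move: a; apply/continuous_circleP].
Qed.

Lemma continuous_hom_inv (f : X -> Hom R) : continuous f ->
  continuous (fun a => hom_inv (f a)).
Proof.
move=> /continuous_HomP cf.
apply/continuous_HomP => x; apply/continuous_circleP => a.
apply: cvgV; first exact: cval_neq0.
by move: a; apply/continuous_circleP.
Qed.

End Continuity.

Lemma calH_seq_continuous (R : realType) k :
  continuous (fun phi : calH R => calH_seq phi k).
Proof. by move: k; apply/(@continuous_calHP R (calH R) id) => a; exact: cvg_id. Qed.

Lemma calT_continuous (R : realType) : continuous (@calT R).
Proof.
apply/continuous_calHP => -[|k]; first exact: calH_seq_continuous.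
by apply: continuous_hom_mul; exact: calH_seq_continuous.
Qed.

Lemma calTinv_continuous (R : realType) : continuous (@calTinv R).
Proof.
apply/continuous_calHP; elim=> [|k IH]; first exact: calH_seq_continuous.
apply: continuous_hom_mul; last exact: calH_seq_continuous.
exact: continuous_hom_inv.
Qed.

Record homeo (X : topologicalType) := Homeo {
  fwd : X -> X;
  bwd : X -> X;
  fwdK : cancel fwd bwd;
  bwdK : cancel bwd fwd;
  fwd_continuous : continuous fwd;
  bwd_continuous : continuous bwd }.

Definition homeo_iter (X : topologicalType) (s : homeo X) (n : int) (x : X) : X :=
  match n with
  | Posz m => iter m (fwd s) x
  | Negz m => iter m.+1 (bwd s) x
  end.

Definition T_homeo (R : realType) : homeo (calH R) :=
  Homeo (@calTK R) (@calTinvK R) (@calT_continuous R) (@calTinv_continuous R).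

Definition Cfun (R : realType) (X : topologicalType) : set (X -> R[i]^o) :=
  [set f | continuous f].
Arguments Cfun R X : clear implicits.

Definition omega (R : realType) (X : topologicalType) (s : homeo X) (x : X)
    (f : X -> R[i]^o) : int -> R[i]^o :=
  fun n => f (homeo_iter s n x).

Definition linfty (R : realType) : set (int -> R[i]^o) :=
  [set u | exists M : R[i], forall n, `|u n| <= M].

(* The uniform topology on int -> C induces the sup-norm topology on linfty,
   which is closed in it. *)
Definition closed_subspace_linfty (R : realType) (V : set (int -> R[i]^o)) : Prop :=
  [/\ V `<=` @linfty R,
      V 0,
      forall (a : R[i]) u v, V u -> V v -> V (a *: u + v) &
      closed (V : set {uniform int -> R[i]^o})].

Definition poly_phase (R : realType) (p : {poly R}) : int -> R[i]^o :=
  fun n => expi (2 * pi * p.[n%:~R]).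

Definition Weyl (R : realType) : set (int -> R[i]^o) :=
  smallest (@closed_subspace_linfty R) (range (@poly_phase R)).
Arguments Weyl R : clear implicits.

(* Main.v *)
(* Solving the recursion for [T] gives that [(T^n 0~)_k] is the power map [x |-> x^binom(n,k)],
   so along the orbit of [0~] the coordinate [phi |-> phi_k(e^(2 pi i t))] takes the values
   [e^(2 pi i t binom(n,k))].  As every real polynomial is a real combination of
   binomial polynomials, products of coordinates yield exactly the polynomial phases.
   Conversely [W] is a conjugation-invariant algebra, hence so is the set of all [f]
   with [omega f] in [W]; it is uniformly closed and contains the coordinates, which
   separate the points of the compact space [H], so by Stone-Weierstrass it contains
   [C(H)].  That [omega C(H)] is closed needs no density of the orbit: restricting
   continuous functions to any subset has uniformly closed range. *)
Require Import Defs.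
From HB Require Import structures.
From mathcomp Require Import all_boot all_order all_algebra complex.
From mathcomp Require Import all_classical all_reals all_analysis.
From mathcomp Require Import ring lra.
Import Order.TTheory GRing.Theory Num.Theory.
Import numFieldNormedType.Exports.
Local Open Scope classical_set_scope.
Local Open Scope ring_scope.
Set Implicit Arguments.
Unset Strict Implicit.
Unset Printing Implicit Defensive.
(* MathComp's homonyms shadow these three. *)
Local Notation Re := (@complex.Re _).
Local Notation Im := (@complex.Im _).
Local Notation Hom := Defs.Hom.

(** * The Stone-Weierstrass theorem *)

Lemma compact_fun_bounded (R : realType) (X : topologicalType) (f : X -> R) :
  compact [set: X] -> continuous f -> exists2 M, 0 < M & forall x, `|f x| <= M.
Proof.
move=> cX cf.
have /compact_bounded/ex_strict_bound_gt0[M M0 fM] : compact (range f).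
  by apply: continuous_compact => //; exact: continuous_subspaceT.
by exists M => // x; apply/ltW/fM; exists x.
Qed.

(* [compact_cover] is only available for pointed spaces. *)
Lemma compact_finite_subcover (X : topologicalType) (K : set X) (O : X -> set X) :
  compact K -> (forall x, K x -> nbhs x (O x)) ->
  exists s : seq X, forall y, K y -> exists2 x, x \in s & O x y.
Proof.
move=> cK KO; apply: contrapT => /forallNP ncov.
(* If no finite subfamily covers [K], the sets [B s] generate a proper filter on [K]; at a cluster
   point [p] the neighbourhood [O p] would have to meet [B [:: p]]. *)
pose B (s : seq X) := [set y | K y /\ forall x, x \in s -> ~ O x y].
have FF : ProperFilter (filter_from [set: seq X] B).
  apply: filter_from_proper.
    apply: filter_from_filter; first by exists [::].
    move=> s t _ _; exists (s ++ t) => // y [Ky nO].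
    by split; split=> // x xs; apply: nO; rewrite mem_cat xs ?orbT.
  move=> s _; have /existsNP[y /not_implyP[Ky nO]] := ncov s.
  by exists y; split=> // x xs Oxy; apply: nO; exists x.
have [|p [Kp clp]] := cK _ FF; first by exists [::] => // y [].
have [|y [[Ky nO] Oy]] := clp (B [:: p]) (O p) _ (KO p Kp); first by exists [:: p].
by apply: nO Oy; rewrite mem_head.
Qed.

Section StoneWeierstrass.
Variables (R : realType) (X : topologicalType) (A : set (X -> R)).
Hypotheses (cX : compact [set: X]) (Ac : forall f, A f -> continuous f)
  (A_cst : forall c, A (fun=> c))
  (AD : forall f g, A f -> A g -> A (fun x => f x + g x))
  (AM : forall f g, A f -> A g -> A (fun x => f x * g x))
  (A_lim : forall f, continuous f ->
    (forall e, 0 < e -> exists2 g, A g & forall x, `|f x - g x| <= e) -> A f)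
  (A_sep : forall x y, x <> y -> exists2 g, A g & g x != g y).

Let A_sum (I : Type) (s : seq I) (F : I -> X -> R) :
  (forall i, A (F i)) -> A (fun x => \sum_(i <- s) F i x).
Proof.
move=> AF; elim: s => [|i s IH].
  by rewrite (_ : (fun _ => _) = fun=> 0) ?funeqE => [|x]; rewrite ?big_nil.
rewrite (_ : (fun _ => _) = fun x => F i x + \sum_(i <- s) F i x).
  exact: AD.
by apply/funext => x; rewrite big_cons.
Qed.

Let A_exp f n : A f -> A (fun x => f x ^+ n).
Proof.
move=> Af; elim: n => [|n IH]; first exact: A_cst.
rewrite (_ : (fun _ => _) = fun x => f x * f x ^+ n); first exact: AM.
by apply/funext => x; rewrite exprS.
Qed.

Let exp_small (r e : R) : 0 <= r < 1 -> 0 < e -> exists n, r ^+ n < e.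
Proof.
move=> /andP[r0 r1] e0.
have /cvgrPdist_lt/(_ _ e0)[N _ NP] : (GRing.exp r : nat -> R) @ \oo --> (0 : R).
  by apply: cvg_expr; rewrite ger0_norm.
exists N; have := NP N (leqnn N).
by rewrite /= sub0r normrN ger0_norm // exprn_ge0.
Qed.

(* [1/f = B^-1 * sum_i (1 - f/B)^i] converges uniformly when [1 <= f <= B]. *)
Let A_inv f : A f -> (forall x, 1 <= f x) -> A (fun x => (f x)^-1).
Proof.
move=> Af f1; have f0 x : f x != 0 by rewrite gt_eqF // (lt_le_trans ltr01).
apply: A_lim => [x|e e0]; first by apply: cvgV => //; exact: Ac.
have [B B0 fB] := compact_fun_bounded cX (Ac Af).
have fleB x : f x <= B by exact: le_trans (ler_norm _) (fB x).
have [[x0]|nX] := pselect (inhabited X); last first.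
  by exists (fun=> 0) => // x; case: nX.
have B1 : 1 <= B := le_trans (f1 x0) (fleB x0).
have [|n rn] := @exp_small (1 - B^-1) e _ e0.
  by rewrite subr_ge0 invf_le1 // B1 ltrBlDr ltrDl invr_gt0.
exists (fun x => B^-1 * \sum_(i <- iota 0 n) (1 + (- B^-1) * f x) ^+ i).
  apply: AM => //; apply: A_sum => i; apply: A_exp.
  by apply: AD => //; exact: AM.
move=> x; set q := 1 + _.
have qE : 1 - q = f x / B by rewrite /q opprD addrA subrr sub0r mulNr opprK mulrC.
have q0 : 0 <= q by rewrite /q mulNr subr_ge0 mulrC ler_pdivrMr // mul1r.
have qr : q <= 1 - B^-1 by rewrite /q mulNr lerD2l lerN2 ler_peMr // invr_ge0 ltW.
(* Since [f x / B] is [1 - q], the remainder of the geometric series is exactly [q ^+ n / f x], at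
   most (1 - 1/B)^n because [f x >= 1]. *)
have -> : (f x)^-1 - B^-1 * \sum_(i <- iota 0 n) q ^+ i = q ^+ n / f x.
  apply: (mulfI (f0 x)); rewrite mulrBr divff // [in RHS]mulrCA divff // mulr1.
  rewrite mulrA -qE.
  have -> : \sum_(i <- iota 0 n) q ^+ i = \sum_(i < n) q ^+ i.
    by rewrite -(big_mkord xpredT (fun i => q ^+ i)) /index_iota subn0.
  by rewrite -(opprB q 1) mulNr opprK -subrX1 subrKC.
rewrite ger0_norm; last by rewrite divr_ge0 ?exprn_ge0 // (le_trans ler01).
rewrite (le_trans _ (ltW rn)) // ler_pdivrMr ?(lt_le_trans ltr01) //.
rewrite (le_trans (lerXn2r n _ _ qr)) ?nnegrE ?(le_trans q0) //.
by rewrite ler_peMr // exprn_ge0 // (le_trans q0).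
Qed.

(** A squared separating function is nonnegative and can be made to vanish at [x]; scaled to the
    value 2 at a point [y] outside [U], it exceeds 1 near [y]. Compactness of the complement of [U]
    leaves finitely many of them to add up. *)
Let A_peak (x : X) (U : set X) : open U -> U x -> exists P : X -> R,
  [/\ A P, P x = 0, forall y, 0 <= P y & forall y, ~ U y -> 1 <= P y].
Proof.
move=> oU Ux.
have sepx y : exists q : X -> R, [/\ A q, q x = 0, forall z, 0 <= q z &
    y <> x -> 1 < q y].
  have [->|yx] := pselect (y = x); first by exists (fun=> 0); split.
  have [g Ag gyx] := A_sep yx; pose c := g y - g x.
  have c0 : c != 0 by rewrite subr_eq0.
  exists (fun z => 2 * (c^-1 * (g z - g x)) * (c^-1 * (g z - g x))); split.
  - have Ah : A (fun z => c^-1 * (g z - g x)) by apply: AM => //; exact: AD.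
    by apply: (AM (f := fun z => 2 * (c^-1 * (g z - g x)))) => //; exact: AM.
  - by rewrite subrr !mulr0.
  - by move=> z; rewrite -mulrA mulr_ge0 // -expr2 sqr_ge0.
  - by move=> _; rewrite -/c mulVf // !mulr1 ltr1n.
have [q qP] := choice sepx.
have cUc : compact (~` U).
  by apply: (subclosed_compact (open_closedC oU) cX).
have [|D DU] := compact_finite_subcover (O := fun y => q y @^-1` [set r | 1 < r]) cUc.
  move=> y Uy; have [Aq _ _ q1] := qP y; apply: (Ac Aq).
  apply: open_nbhs_nbhs; split; first exact: open_gt.
  by apply: q1 => yx; apply: Uy; rewrite yx.
exists (fun z => \sum_(y <- D) q y z); split.
- by apply: A_sum => y; case: (qP y).
- by apply: big1 => y _; case: (qP y).
- by move=> z; apply: sumr_ge0 => y _; case: (qP y).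
- move=> z /DU [y yD] /= /ltW q1; rewrite (big_rem y) //=.
  by rewrite (le_trans q1) // lerDl sumr_ge0 // => w _; case: (qP w).
Qed.

(** With [P] from [A_peak], the function [3 / 2 * (1 + P)^-1] is 3/2 at [x] and at most 3/4 outside
    [U]. Its powers stay above 1 near [x] and become uniformly small outside [U]. *)
Let A_bump (x : X) (U : set X) : open U -> U x -> exists L : X -> R,
  [/\ A L, 1 < L x, forall y, 0 <= L y & forall y, ~ U y -> L y <= 3 / 4].
Proof.
move=> oU Ux; have [P [AP P0 Pge PU]] := A_peak oU Ux.
exists (fun y => 3 / 2 * (1 + P y)^-1); split.
- apply: AM => //; apply: A_inv; first exact: AD.
  by move=> y; rewrite lerDl.
- by rewrite P0 addr0 invr1 mulr1; lra.
- by move=> y; rewrite mulr_ge0 ?invr_ge0 ?addr_ge0 //; lra.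
- move=> y /PU P1; rewrite ler_pdivrMr; last by lra.
  by lra.
Qed.

(** The weights [L x y ^+ n / S y], for [x] in a finite list [s], form a partition of unity, and
    [f y] is compared with the weighted mean of the values [f x]. For large [n], those [x] with
    [f x] far from [f y] carry little weight. *)
Theorem stone_weierstrass f : continuous f -> A f.
Proof.
move=> cf; apply: A_lim => // e e0.
pose U x := f @^-1` ball (f x) (e / 2).
have e20 : 0 < e / 2 by rewrite divr_gt0.
have bump x : exists L : X -> R, [/\ A L, 1 < L x, forall y, 0 <= L y &
    forall y, ~ U x y -> L y <= 3 / 4].
  apply: A_bump; last exact: ballxx.
  by apply: open_comp; [move=> y _; exact: cf|exact: ball_open].
have [L LP] := choice bump.
have [|s sX] := compact_finite_subcover (O := fun x => L x @^-1` [set r | 1 < r]) cX.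
  move=> x _; have [AL L1 _ _] := LP x; apply: (Ac AL).
  by apply: open_nbhs_nbhs; split; first exact: open_gt.
have [M M0 fM] := compact_fun_bounded cX cf.
(* The points [x] with [y] outside [U x] contribute at most [size s] times [2 * M] times (3/4)^n,
   which is to stay below e/2; the added 1 keeps [C] positive when [s] is empty. *)
pose C := (size s)%:R * (2 * M) + 1.
have C0 : 0 < C by rewrite ltr_wpDl // mulr_ge0 // mulr_ge0 // ltW.
have [|n small] := @exp_small (3 / 4) (e / 2 / C) _ (divr_gt0 e20 C0); first lra.
pose S y := \sum_(x <- s) L x y ^+ n.
have AK x : A (fun y => L x y ^+ n) by apply: A_exp; case: (LP x).
have K0 x y : 0 <= L x y ^+ n by apply: exprn_ge0; case: (LP x).
have S1 y : 1 <= S y.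
  have [x xs /= Lx] := sX y I; rewrite /S (big_rem x) //=.
  by rewrite -[leLHS]addr0 lerD ?sumr_ge0 ?exprn_ege1 // ltW.
exists (fun y => (\sum_(x <- s) f x * L x y ^+ n) * (S y)^-1).
  apply: AM; first by apply: A_sum => x; exact: AM.
  by apply: A_inv => //; exact: A_sum.
move=> y; have S0 : 0 < S y by exact: lt_le_trans (S1 y).
have -> : f y - (\sum_(x <- s) f x * L x y ^+ n) * (S y)^-1 =
    (\sum_(x <- s) (f y - f x) * L x y ^+ n) / S y.
  under [in RHS]eq_bigr do rewrite mulrBl.
  by rewrite sumrB -mulr_sumr mulrBl -/(S y) mulfK // gt_eqF.
rewrite normrM normfV (gtr0_norm S0) ler_pdivrMr // (le_trans (ler_norm_sum _ _ _)) //.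
(* One bound serves both cases, so the sum over [s] is not split: the first terms add up to
   [e / 2 * S y], the second ones to at most e/2, and [S y >= 1]. *)
have bd x : `|(f y - f x) * L x y ^+ n| <= e / 2 * L x y ^+ n + 2 * M * (e / 2 / C).
  rewrite normrM (ger0_norm (K0 x y)).
  have [Uy|Uy] := pselect (U x y).
    rewrite -[leLHS]addr0 lerD //.
      by rewrite ler_wpM2r // distrC ltW.
    by rewrite !mulr_ge0 ?invr_ge0 // ltW.
  rewrite -[leLHS]add0r lerD //; first by rewrite mulr_ge0 // ltW.
  rewrite ler_pM //.
    by rewrite (le_trans (ler_normB _ _)) // mulr_natl mulr2n lerD.
  rewrite (le_trans _ (ltW small)) // lerXn2r ?nnegrE //.
    by case: (LP x).
  by case: (LP x) => _ _ _; apply.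
rewrite (le_trans (ler_sum _ (fun x _ => bd x))) // big_split /= -mulr_sumr -/(S y).
rewrite big_const_seq count_predT iter_addr_0 -[_ *+ size s]mulr_natl mulrA.
have -> : e * S y = e / 2 * S y + e / 2 * S y by rewrite -mulrDl -splitr.
rewrite lerD2l; apply: (@le_trans _ _ (e / 2)); last by rewrite ler_peMr // ltW.
rewrite [leLHS](_ : _ = e / 2 * ((size s)%:R * (2 * M) * C^-1)); last by ring.
apply: ler_piMr; first exact: ltW.
rewrite ler_pdivrMr // mul1r /C; lra.
Qed.

End StoneWeierstrass.

(** * Uniform closedness of restrictions of continuous functions *)

Section UniformlyClosedRestriction.
Variables (R : realType) (X : topologicalType) (I : Type) (e : I -> X) (u : I -> R).
Hypothesis approx : forall d, 0 < d ->
  exists2 f : X -> R, continuous f & forall i, `|u i - f (e i)| <= d.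

(* Truncating each increment makes approximants that are only close to each other
   on the image of [e] uniformly Cauchy on all of [X]. *)
Lemma uniformly_closed_restriction :
  exists2 F : X -> R, continuous F & forall i, F (e i) = u i.
Proof.
pose d k : R := 2^-1 ^+ k.
have d0 k : 0 < d k by rewrite exprn_gt0 // invr_gt0.
have dS k : d k = 2 * d k.+1 by rewrite /d exprS mulrA divff // mul1r.
have /choice[f fP] k : exists f : X -> R,
    continuous f /\ forall i, `|u i - f (e i)| <= d k.
  by have [f cf fu] := approx (d0 k); exists f.
(* Clamping to a band of half-width [2 * d k] keeps consecutive functions close everywhere. It
   changes nothing on the image of [e], where [f k] and [f k.+1] differ by at most [d k + d k.+1],
   that is 3/2 of [d k]. *)
pose step k (g : X -> R) : X -> R :=
  (fun x => g x - 2 * d k) \max ((fun x => g x + 2 * d k) \min f k.+1).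
pose G := fix G k := if k is k'.+1 then step k' (G k') else f 0%N.
have cG k : continuous (G k).
  elim: k => [|k IH]; first by case: (fP 0%N).
  move=> x; rewrite /= /step; apply: continuous_max.
    by apply: cvgB; [exact: IH|exact: cvg_cst].
  apply: continuous_min; last by case: (fP k.+1) => + _; apply.
  by apply: cvgD; [exact: IH|exact: cvg_cst].
have Ge k i : G k (e i) = f k (e i).
  elim: k => [//|k IH]; rewrite /= /step /= IH.
  have := (fP k).2 i; have := (fP k.+1).2 i; rewrite !ler_norml.
  move=> /andP[a b] /andP[c h]; have := dS k; have := d0 k => ? ?.
  by rewrite min_r ?max_r //; lra.
have Gstep k x : `|G k.+1 x - G k x| <= 2 * d k.
  have := d0 k; rewrite /= /step /= => ?; rewrite ler_norml.
  apply/andP; split; first by rewrite lerBrDl le_max lexx.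
  rewrite lerBlDl ge_max ge_min lexx andbT; lra.
(* The increments from stage [k] on sum to at most [4 * d k], so the limit is squeezed between the
   nondecreasing [b] and the nonincreasing [a], and can be taken as an infimum. *)
pose a k x := G k x + 4 * d k; pose b k x := G k x - 4 * d k.
have aS k x : a k.+1 x <= a k x.
  by have := Gstep k x; rewrite ler_norml /a => /andP[? ?]; have := dS k; lra.
have bS k x : b k x <= b k.+1 x.
  by have := Gstep k x; rewrite ler_norml /b => /andP[? ?]; have := dS k; lra.
have ba j k x : b j x <= a k x.
  have amono m n : (m <= n)%N -> a n x <= a m x.
    by move=> /subnK <-; elim: (n - m)%N => // l; apply: le_trans (aS _ _).
  have bmono m n : (m <= n)%N -> b m x <= b n x.
    by move=> /subnK <-; elim: (n - m)%N => // l IH; apply: le_trans IH (bS _ _).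
  rewrite (le_trans (bmono _ _ (leq_maxl j k))) // (le_trans _ (amono _ _ (leq_maxr j k))) //.
  by rewrite /a /b; have := d0 (maxn j k); lra.
pose F x := inf (range (a^~ x)).
have Fa k x : F x <= a k x.
  apply: ge_inf; last by exists k.
  by exists (b 0%N x) => _ [j _ <-].
have Fb k x : b k x <= F x.
  by apply: lb_le_inf; [exists (a 0%N x); exists 0%N|move=> _ [j _ <-]].
have FG k x : `|G k x - F x| <= 4 * d k.
  by rewrite ler_norml; have := Fa k x; have := Fb k x; rewrite /a /b; lra.
have small eps : 0 < eps -> \forall k \near \oo, 4 * d k < eps.
  move=> eps0; have : (fun k => 4 * d k) @ \oo --> (4 * 0 : R).
    apply: cvgM; first exact: cvg_cst.
    apply: cvg_expr; rewrite ger0_norm ?invr_ge0 //; lra.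
  rewrite mulr0 => /cvgrPdist_lt/(_ _ eps0); apply: filterS => k.
  by rewrite sub0r normrN ger0_norm // mulr_ge0 // ltW.
have uGF : {uniform, G @ \oo --> F}.
  move=> P /uniform_nbhs[E []]; rewrite -entourage_ballE => -[eps /= eps0 epsE] EP.
  apply: filterS (small _ eps0) => k kE; apply: EP => x _; apply: epsE => /=.
  by rewrite -ball_normE /= distrC (le_lt_trans (FG k x)).
exists F.
  by apply: (uniform_limit_continuous _ _ uGF); near_simpl; exact: nearW.
move=> i; apply/eqP; apply: contraT => Fu.
have /small[k _ /(_ k (leqnn k)) /=] : 0 < `|F (e i) - u i| / 2.
  by rewrite divr_gt0 // normr_gt0 subr_eq0.
have := FG k (e i); have := (fP k).2 i; rewrite -Ge.
have := ler_distD (G k (e i)) (F (e i)) (u i); have := d0 k.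
rewrite (distrC (F _) (G _ _)) (distrC (G _ _) (u _)); lra.
Qed.

End UniformlyClosedRestriction.

(** * The complex plane and the unit circle *)

Section ComplexTopology.
Variable R : realType.
Implicit Types (z w : R[i]^o) (X : topologicalType).
Local Open Scope complex_scope.

Lemma complex_gt0 (e : R[i]) : 0 < e -> exists2 d : R, 0 < d & e = d%:C.
Proof.
case: e => a b; rewrite ltcE /= => /andP[/eqP b0 a0].
by exists a => //; apply/eqP; rewrite eq_complex /= b0 !eqxx.
Qed.

Lemma normc_le_add z : `|z| <= (`|Re z| + `|Im z|)%:C.
Proof.
rewrite normc_def lecR -[leRHS]ger0_norm ?addr_ge0 // -sqrtr_sqr ler_wsqrtr //.
rewrite sqrrD !real_normK ?num_real // addrAC lerDl.
by rewrite mulrn_wge0 // mulr_ge0.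
Qed.

Lemma normc_ge_Im z : `|Im z|%:C <= `|z|.
Proof. by rewrite normc_def lecR -sqrtr_sqr ler_wsqrtr // lerDr sqr_ge0. Qed.

Lemma continuous_Re : continuous (Re : R[i]^o -> R).
Proof.
move=> z; apply/(@cvgrPdist_lt _ _ _ (nbhs z) (nbhs_filter z)) => e e0.
apply/(@nbhs_normP R[i] R[i]^o); exists e%:C => [|w] /=; first by rewrite ltcR.
rewrite -raddfB /= -ltcR; apply: le_lt_trans.
exact: normc_ge_Re.
Qed.

Lemma continuous_Im : continuous (Im : R[i]^o -> R).
Proof.
move=> z; apply/(@cvgrPdist_lt _ _ _ (nbhs z) (nbhs_filter z)) => e e0.
apply/(@nbhs_normP R[i] R[i]^o); exists e%:C => [|w] /=; first by rewrite ltcR.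
rewrite -raddfB /= -ltcR; apply: le_lt_trans.
exact: normc_ge_Im.
Qed.

Lemma continuous_Re_comp X (f : X -> R[i]^o) : continuous f ->
  continuous (fun x => Re (f x)).
Proof. by move=> cf x; apply: continuous_comp (cf x) _; exact: continuous_Re. Qed.

Lemma continuous_Im_comp X (f : X -> R[i]^o) : continuous f ->
  continuous (fun x => Im (f x)).
Proof. by move=> cf x; apply: continuous_comp (cf x) _; exact: continuous_Im. Qed.

Lemma continuous_complex X (f g : X -> R) : continuous f -> continuous g ->
  continuous (fun x => f x +i* g x : R[i]^o).
Proof.
move=> cf cg x; apply/cvgrPdist_lt => _ /complex_gt0[e e0 ->].
have e20 : 0 < e / 2 by rewrite divr_gt0.
have /cvgrPdist_lt/(_ _ e20) := cg x; have /cvgrPdist_lt/(_ _ e20) := cf x.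
apply: filterS2 => y fe ge; rewrite (le_lt_trans (normc_le_add _)) // ltcR /=.
by rewrite (splitr e) ltrD.
Qed.

Lemma expiD (s t : R) : expi (s + t) = expi s * expi t.
Proof.
rewrite /expi cosD sinD; apply/eqP; rewrite eq_complex /=.
by apply/andP; split; apply/eqP; rewrite // addrC.
Qed.

Lemma expi0 : expi (0 : R) = 1.
Proof. by rewrite /expi cos0 sin0. Qed.

Lemma expi_conj (t : R) : (expi t)^*%C = expi (- t).
Proof. by rewrite /expi cosN sinN. Qed.

Lemma expiN (t : R) : expi (- t) = (expi t)^-1.
Proof.
have e1 : expi (- t) * expi t = 1 by rewrite -expiD addNr expi0.
have t0 : expi t != 0.
  by apply/eqP => t0; move/eqP: e1; rewrite t0 mulr0 eq_sym oner_eq0.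
by apply: (mulIf t0); rewrite e1 mulVf.
Qed.

Lemma norm_expi (t : R) : `|expi t| = 1.
Proof. by rewrite normc_def /= cos2Dsin2 sqrtr1. Qed.

Lemma continuous_expi : continuous (@expi R).
Proof. by apply: continuous_complex; [exact: continuous_cos|exact: continuous_sin]. Qed.

(** The angle is [acos] of the real part, with the sign of the imaginary part. Confining it to a
    segment yields compactness of the circle. *)
Lemma expi_surj z : `|z| = 1 -> exists2 t : R, t \in `[- pi, pi] & expi t = z.
Proof.
case: z => a b /eqP; rewrite normc_def eq_complex /= eqxx andbT => /eqP ab.
have {}ab : a ^+ 2 + b ^+ 2 = 1.
  by rewrite -[LHS]sqr_sqrtr ?addr_ge0 ?sqr_ge0 // ab expr1n.
have a1 : -1 <= a <= 1.
  rewrite -ler_norml -[leLHS]ger0_norm // -ler_sqr ?nnegrE // normr_id real_normK ?num_real //.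
  by rewrite expr1n -ab lerDl sqr_ge0.
have sa : sin (acos a) = `|b|.
  by rewrite sin_acos // -sqrtr_sqr -ab addrAC subrr add0r.
have [b0|b0] := leP 0 b.
  exists (acos a); last by rewrite /expi acosK // sa ger0_norm.
  rewrite in_itv /= acos_lepi // andbT (le_trans _ (acos_ge0 a1)) //.
  by rewrite oppr_le0 pi_ge0.
exists (- acos a); last by rewrite /expi cosN sinN acosK // sa ltr0_norm // opprK.
rewrite in_itv /= lerN2 acos_lepi //= (@le_trans _ _ 0) ?pi_ge0 //.
by rewrite oppr_le0 acos_ge0.
Qed.

Lemma hausdorff_complex : hausdorff_space R[i]^o.
Proof. exact: norm_hausdorff. Qed.

Lemma continuous_addc X (f g : X -> R[i]^o) : continuous f -> continuous g ->
  continuous (fun x => f x + g x : R[i]^o).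
Proof. by move=> cf cg x; apply: cvgD; [exact: cf|exact: cg]. Qed.

Lemma continuous_mulc X (f g : X -> R[i]^o) : continuous f -> continuous g ->
  continuous (fun x => f x * g x : R[i]^o).
Proof. by move=> cf cg x; apply: cvgM; [exact: cf|exact: cg]. Qed.

Lemma closed_eq_complex X (f g : X -> R[i]^o) : continuous f -> continuous g ->
  closed [set x | f x = g x].
Proof.
move=> cf cg; rewrite (_ : [set _ | _] = (fun x => f x - g x) @^-1` [set 0]).
  apply: closed_comp.
    by move=> x _; apply: cvgB; [exact: cf|exact: cg].
  apply: accessible_closed_set1; apply: hausdorff_accessible.
  exact: hausdorff_complex.
by apply/seteqP; split=> x /= => [->|/eqP]; rewrite ?subrr // subr_eq0 => /eqP.
Qed.

End ComplexTopology.

(** * Stone-Weierstrass for complex-valued functions *)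

Section ComplexStoneWeierstrass.
Variables (R : realType) (X : topologicalType) (A : set (X -> R[i]^o)).
Local Open Scope complex_scope.
Hypotheses (cX : compact [set: X])
  (A_cst : forall c, A (fun=> c))
  (AD : forall f g, A f -> A g -> A (fun x => f x + g x))
  (AM : forall f g, A f -> A g -> A (fun x => f x * g x))
  (AJ : forall f, A f -> A (fun x => (f x)^*%C))
  (A_lim : forall f : X -> R[i]^o,
    (forall e : R, 0 < e -> exists2 g, A g & forall x, `|f x - g x| <= e%:C) -> A f)
  (A_sep : forall x y, x <> y -> exists g, [/\ A g, continuous g & g x <> g y]).

Let A_Re f : A f -> A (fun x => (Re (f x))%:C).
Proof.
move=> Af; rewrite (_ : (fun _ => _) = fun x => (f x + (f x)^*%C) * 2^-1).
  by apply: AM => //; apply: AD => //; exact: AJ.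
by apply/funext => x; exact: ReJ_add.
Qed.

Let A_Im f : A f -> A (fun x => (Im (f x))%:C).
Proof.
move=> Af.
rewrite (_ : (fun _ => _) = fun x => ((f x)^*%C + -1 * f x) * 2^-1 * 'i%C).
  by apply: AM => //; apply: AM => //; apply: AD; [exact: AJ|exact: AM].
by apply/funext => x; rewrite mulN1r; exact: ImJ_sub.
Qed.

(** Stability under conjugation puts real and imaginary parts in [A]. As [A] is not assumed to
    consist of continuous functions, the real theorem is applied to the continuous real functions
    whose complexification lies in [A]. *)
Theorem complex_stone_weierstrass f : continuous f -> A f.
Proof.
move=> cf.
have real_sw (h : X -> R) : continuous h -> continuous h /\ A (fun x => (h x)%:C).
  apply: (@stone_weierstrass R X
    [set g : X -> R | continuous g /\ A (fun x => (g x)%:C)]) => //.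
  - by move=> h1 [].
  - by move=> c; split; [exact: cst_continuous|exact: A_cst].
  - move=> h1 h2 [c1 A1] [c2 A2]; split.
      by move=> x; apply: cvgD; [exact: c1|exact: c2].
    rewrite (_ : (fun _ => _) = fun x => (h1 x)%:C + (h2 x)%:C); first exact: AD.
    by apply/funext => x; rewrite rmorphD.
  - move=> h1 h2 [c1 A1] [c2 A2]; split.
      by move=> x; apply: cvgM; [exact: c1|exact: c2].
    rewrite (_ : (fun _ => _) = fun x => (h1 x)%:C * (h2 x)%:C); first exact: AM.
    by apply/funext => x; rewrite rmorphM.
  - move=> h1 ch happ; split=> //; apply: A_lim => e /happ[h2 [_ Ah2] hh].
    exists (fun x => (h2 x)%:C) => // x.
    by rewrite -rmorphB normc_def /= expr0n addr0 sqrtr_sqr lecR.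
  - move=> x y /A_sep[g [Ag cg gxy]].
    have [Rexy|Rexy] := eqVneq (Re (g x)) (Re (g y)); last first.
      exists (fun x => Re (g x)) => //.
      by split; [exact: continuous_Re_comp|exact: A_Re].
    exists (fun x => Im (g x)).
      by split; [exact: continuous_Im_comp|exact: A_Im].
    by apply/eqP => Imxy; apply/gxy/eqP; rewrite eq_complex Rexy Imxy !eqxx.
have [_ ARe] := real_sw _ (continuous_Re_comp cf).
have [_ AIm] := real_sw _ (continuous_Im_comp cf).
rewrite (_ : f = fun x => (Re (f x))%:C + 'i%C * (Im (f x))%:C).
  by apply: AD => //; exact: AM.
by apply/funext => x; rewrite {1}[f x]complexE.
Qed.

End ComplexStoneWeierstrass.

(** * Compactness of the phase space *)

(** Neighbourhoods in the initial topology contain preimages of open sets, so any point above a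
    cluster point of the image filter is itself a cluster point. *)
Lemma compact_initial (S : choiceType) (Y : topologicalType) (f : S -> Y) :
  compact (range f) -> compact [set: initial_topology f].
Proof.
move=> cf F FF _.
have Ff : F (f @^-1` range f) by apply: filterS filterT => s _; exists s.
have [_ [[s _ <-] cl]] := cf (f @ F) (fmap_proper_filter f FF) Ff.
exists s; split=> // A B FA [_ [[C oC <-] Cs CB]].
have FfA : F (f @^-1` (f @` A)) by apply: filterS FA => t At; exists t.
have [_ [[t At <-] Ct]] := cl _ C FfA (open_nbhs_nbhs (conj oC Cs)).
by exists t; split=> //; exact: CB.
Qed.

Lemma compact_set_type (Y : topologicalType) (K : set Y) :
  compact K -> compact [set: set_type K].
Proof.
move=> cK; apply: compact_initial.
rewrite (_ : range _ = K) //; apply/seteqP; split=> [_ [x _ <-]|y Ky].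
  exact: set_valP.
by exists (SigSub (mem_set Ky)).
Qed.

Section CompactH.
Variable R : realType.

Lemma compact_circle : compact [set: circle R].
Proof.
apply: compact_set_type.
rewrite (_ : [set _ | _] = @expi R @` `[- pi, pi]).
  apply: continuous_compact; last exact: segment_compact.
  by apply: continuous_subspaceT; exact: continuous_expi.
apply/seteqP; split=> [z /= /expi_surj[t tpi tz]|_ [t _ <-]]; last exact: norm_expi.
by exists t.
Qed.

Lemma continuous_eval_ptws (x : circle R) :
  continuous (fun f : {ptws circle R -> circle R} => cval (f x)).
Proof.
apply/continuous_circleP; move: x; apply/(@continuous_ptwsP _ _ _ id).
by move=> f; exact: cvg_id.
Qed.

(** The space of all maps is compact by Tychonoff, and each instance of multiplicativity is a closed
    condition on three evaluations. *)
Lemma compact_Hom : compact [set: Hom R].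
Proof.
apply: compact_set_type.
apply: (@subclosed_compact _ _ setT) => //; last first.
  have := @tychonoff (circle R) (fun=> circle R) (fun=> setT) (fun=> compact_circle).
  by rewrite (_ : [set _ | _] = setT) // eqEsubset; split.
rewrite (_ : [set _ | _] = \bigcap_(xy : circle R * circle R) [set f |
    cval (f (xy.1 * xy.2)%g) = cval (f xy.1) * cval (f xy.2)]).
  apply: closed_bigI => -[x y] _; apply: closed_eq_complex.
    exact: continuous_eval_ptws.
  by apply: continuous_mulc; exact: continuous_eval_ptws.
apply/seteqP; split=> f /= fM; first by move=> [x y] _ /=; rewrite fM.
by move=> x y; apply: cval_inj; exact: (fM (x, y)).
Qed.

Lemma continuous_expn (X : topologicalType) (f : X -> R[i]^o) n :
  continuous f -> continuous (fun x => f x ^+ n : R[i]^o).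
Proof.
move=> cf; elim: n => [|n IH]; first by move=> x; exact: cvg_cst.
rewrite (_ : (fun _ => _) = fun x => f x * f x ^+ n); first exact: continuous_mulc.
by apply/funext => y; rewrite exprS.
Qed.

Lemma continuous_sumc (X : topologicalType) (I : Type) (r : seq I)
    (F : I -> X -> R[i]^o) :
  (forall i, continuous (F i)) -> continuous (fun x => \sum_(i <- r) F i x : R[i]^o).
Proof.
move=> cF; elim: r => [|i r IH].
  rewrite (_ : (fun _ => _) = fun=> 0); first by move=> x; exact: cvg_cst.
  by apply/funext => x; rewrite big_nil.
rewrite (_ : (fun _ => _) = fun x => F i x + \sum_(i <- r) F i x).
  by apply: continuous_addc; [exact: cF|exact: IH].
by apply/funext => x; rewrite big_cons.
Qed.

(* [v ^ N - w ^ N = (v - w) s(v)] where [s(w) = N w ^ (N - 1)] is not zero. *)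
Lemma torsion_isolated (w : circle R) N : (0 < N)%N -> (w ^+ N)%g = 1%g ->
  \forall v \near w, (v ^+ N)%g = 1%g -> v = w.
Proof.
move=> N0 wN.
pose s (v : circle R) : R[i]^o := \sum_(i < N) cval v ^+ (N.-1 - i) * cval w ^+ i.
have cs : continuous s.
  have cv : continuous (fun v : circle R => cval v).
    by apply/(@continuous_circleP _ (circle R) id) => v; exact: cvg_id.
  apply: continuous_sumc => i; apply: continuous_mulc.
    exact: continuous_expn.
  exact: cst_continuous.
have sw : s w != 0.
  rewrite /s (eq_bigr (fun=> cval w ^+ N.-1)); last first.
    by move=> i _; rewrite -exprD subnK // -ltnS prednK.
  by rewrite sumr_const card_ord mulrn_eq0 negb_or expf_neq0 ?cval_neq0 // -lt0n N0.
have : nbhs w (~` [set v | s v = 0]).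
  apply: open_nbhs_nbhs; split; last exact/eqP.
  apply: closed_openC; apply: (@closed_eq_complex _ _ s (fun=> 0)); [exact: cs|exact: cst_continuous].
apply: filterS => v /eqP sv vN; apply: cval_inj; apply/eqP; rewrite -subr_eq0.
have /eqP : (cval v - cval w) * s v = 0.
  by rewrite /s -subrXX -!cvalX vN wN subrr.
by rewrite mulf_eq0 (negPf sv) orbF.
Qed.


Lemma circleQ_torsion (x : circle R) : circleQ x ->
  exists2 N, (0 < N)%N & (x ^+ N)%g = 1%g.
Proof.
move=> [q xq]; have d0 : denq q != 0 by exact: denq_neq0.
exists `|denq q|%N; first by rewrite absz_gt0.
apply: cval_inj; rewrite cvalX xq cval1.
have expiX t n : expi t ^+ n = expi (n%:R * t) :> R[i]^o.
  elim: n => [|n IH]; first by rewrite mul0r expi0.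
  by rewrite exprS IH -expiD -natr1 mulrDl mul1r addrC.
have expi2pi : expi (pi *+ 2) = 1 :> R[i]^o by rewrite /expi cos2pi sin2pi.
rewrite expiX.
have -> : (`|denq q|%N)%:R * (2 * pi * ratr q) = (numq q)%:~R * (pi *+ 2) :> R.
  rewrite natr_absz gtr0_norm ?denq_gt0 // /ratr -[pi *+ 2]mulr_natl.
  by rewrite [LHS]mulrCA [RHS]mulrC; congr (_ * _); rewrite mulrC divfK // intr_eq0.
case: (numq q) => n; first by rewrite -pmulrn -expiX expi2pi expr1n.
by rewrite NegzE rmorphN mulNr expiN /= -pmulrn -expiX expi2pi expr1n invr1.
Qed.

(* [phi |-> phi (phi z)] need not be continuous for pointwise convergence; here the
   inner value only ranges over roots of unity of order [N], so it is locally constant. *)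
Lemma continuous_iter_torsion (X : topologicalType) (h : X -> Hom R) j
    (z : circle R) N : (0 < N)%N -> (z ^+ N)%g = 1%g -> continuous h ->
  continuous (fun a => iter j (h a) z).
Proof.
move=> N0 zN ch; have ch' := (@continuous_HomP R X h).1 ch.
have gN k a : (iter k (h a) z ^+ N)%g = 1%g.
  elim: k => [//|k IH] /=; rewrite -homX IH; exact: (homX (h a) 1%g 0).
elim: j => [|j IH]; first exact: cst_continuous.
move=> a0 /=; have near_cst : \forall a \near a0, iter j (h a) z = iter j (h a0) z.
  have := IH a0 _ (torsion_isolated N0 (gN j a0)).
  by apply: (@filterS _ (nbhs a0)) => a; apply; exact: gN.
apply: cvg_trans (ch' (iter j (h a0) z) a0).
by apply: near_eq_cvg; apply: (@filterS _ (nbhs a0) _ _ _ _ near_cst) => a /= ->.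
Qed.

(** The defining equations iterate [phi 1] only on [circleQ], whose points are torsion. Hence both
    sides are continuous in [phi], and the equations cut out a closed subset of a compact
    product. *)
Lemma compact_calH : compact [set: calH R].
Proof.
apply: compact_set_type.
apply: (@subclosed_compact _ _ setT) => //; last first.
  have := @tychonoff nat (fun=> Hom R) (fun=> setT) (fun=> compact_Hom).
  by rewrite (_ : [set _ | _] = setT) // eqEsubset; split.
pose Y : topologicalType := {ptws nat -> Hom R}.
have cpr k : continuous (fun phi : Y => phi k : Hom R).
  by move: k; apply/(@continuous_ptwsP Y _ _ id) => f; exact: cvg_id.
have cev k x : continuous (fun phi : Y => cval ((phi k : Hom R) x)).
  by apply/continuous_circleP; move: x; apply/continuous_HomP.
rewrite (_ : calH_set (R := R) =
    (\bigcap_x [set phi : Y | cval ((phi 0%N : Hom R) x) = cval (hom_pow R 1 x)]) `&`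
    \bigcap_(xk in [set xk : circle R * nat | circleQ xk.1 /\ (0 < xk.2)%N])
      [set phi : Y | cval ((phi xk.2 : Hom R) (xk.1 ^+ xk.2`!)%g) =
        cval (\prod_(1 <= j < xk.2.+1)
          iter j (phi 1%N : Hom R) (zexpg xk.1 (stirling1 xk.2 j)))%g]).
  apply: closedI; apply: closed_bigI.
    by move=> x _; apply: closed_eq_complex; [exact: cev|exact: cst_continuous].
  move=> -[x k] /= [Qx k0]; apply: closed_eq_complex; first exact: cev.
  have [N N0 xN] := circleQ_torsion Qx.
  rewrite /index_iota; elim: (iota _ _) => [|j r IH].
    rewrite (_ : (fun _ => _) = fun=> 1); first exact: cst_continuous.
    by apply/funext => phi; rewrite big_nil.
  rewrite (_ : (fun _ => _) = fun phi : Y =>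
    cval (iter j (phi 1%N : Hom R) (zexpg x (stirling1 k j))) *
    cval (\prod_(j <- r) iter j (phi 1%N : Hom R) (zexpg x (stirling1 k j)))%g).
    apply: continuous_mulc; last exact: IH.
    apply/continuous_circleP; apply: continuous_iter_torsion N0 _ _ => //.
    apply: cval_inj; rewrite cvalX cval_zexpg exprnP exprzAC -exprnP -cvalX xN.
    by rewrite exp1rz.
  by apply/funext => phi; rewrite big_cons.
apply/seteqP; split=> phi.
  by move=> [phi0 phiP]; split=> [x _|[x k] [Qx k0]] /=; rewrite ?phi0 ?phiP.
move=> [phi0 phiP]; split; first by apply: hom_ext => x; apply: cval_inj; exact: phi0.
by move=> x k Qx k0; apply: cval_inj; exact: (phiP (x, k)).
Qed.

End CompactH.

(** * The orbit of the zero sequence *)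

Section Orbit.
Variable R : realType.
Implicit Types (p q : {poly R}) (y : R).

Definition binomp (k : nat) : {poly R} :=
  (k`!%:R)^-1 *: map_poly (intr : int -> R) (falling k).

Lemma binomp0 : binomp 0%N = 1.
Proof.
by rewrite /binomp /falling big_ord0 !rmorph1 invr1 scale1r.
Qed.

Lemma binomp_at0 k : (binomp k).[0] = (k == 0%N)%:R.
Proof.
case: k => [|k]; first by rewrite binomp0 hornerC.
by rewrite /binomp hornerZ horner_coef0 coef_map /= falling_coef0 // mulr0.
Qed.

(** Pascal's rule is [falling_shift] divided by (k+1)!. It has the shape of the recursion in [seqT],
    so [T] moves the upper argument [y] to [y + 1]. *)
Lemma binomp_pascal k y : (binomp k.+1).[y + 1] = (binomp k).[y] + (binomp k.+1).[y].
Proof.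
have := congr1 (fun p : {poly int} => (map_poly (intr : int -> R) p).[y]) (falling_shift k).
rewrite map_comp_poly rmorphD rmorphD /= map_polyX rmorph1 horner_comp.
rewrite hornerD hornerX hornerC hornerD map_polyZ hornerZ rmorph_nat /binomp !hornerZ => ->.
rewrite mulrDr addrC mulrA; congr (_ * _ + _).
by rewrite factS natrM invfM mulrAC mulVf ?mul1r // pnatr_eq0.
Qed.

Lemma size_binomp k : size (binomp k) = k.+1.
Proof.
rewrite size_scale ?invr_eq0 ?pnatr_eq0 -?lt0n ?fact_gt0 //.
by rewrite size_map_inj_poly ?size_falling // => m n /eqP; rewrite eqr_int => /eqP.
Qed.

(** This is the power map with exponent binom(y, k), written through angles so that the exponent may
    be handled as a real number. Because every angle [t] of [x] is allowed, integrality of the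
    exponent is implied. *)
Definition is_binom_seq (phi : nat -> Hom R) y :=
  forall k x t, cval x = expi t -> cval (phi k x) = expi (t * (binomp k).[y]).

Lemma seqT_binom phi y : is_binom_seq phi y -> is_binom_seq (seqT phi) (y + 1).
Proof.
move=> phiy [|k] x t xt /=; first by rewrite (phiy _ _ _ xt) binomp0 !hornerC.
by rewrite cvalM (phiy _ _ _ xt) (phiy _ _ _ xt) -expiD -mulrDr -binomp_pascal.
Qed.

Lemma seqTinv_binom phi y : is_binom_seq phi y -> is_binom_seq (seqTinv phi) (y - 1).
Proof.
move=> phiy; elim=> [|k IH] x t xt /=; first by rewrite (phiy _ _ _ xt) binomp0 !hornerC.
rewrite cvalM cvalV (IH _ _ xt) (phiy _ _ _ xt) -expiN -expiD -mulrN -mulrDr.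
by rewrite -[in (binomp k.+1).[y]](subrK 1 y) binomp_pascal addKr.
Qed.

(** At [y = 0] the binomials with [k > 0] vanish, which gives the zero sequence; each application of
    [T] or of its inverse then moves [y] by one. *)
Lemma orbit_binom (n : int) :
  is_binom_seq (calH_seq (homeo_iter (T_homeo R) n (zero_tilde R))) n%:~R.
Proof.
have z0 : is_binom_seq (calH_seq (zero_tilde R)) 0.
  move=> k x t xt; rewrite binomp_at0; case: k => [|k] /=.
    by rewrite mulr1 -xt.
  by rewrite mulr0 expi0.
case: n => m; rewrite /homeo_iter.
  rewrite -pmulrn; elim: m => [|m IH]; first exact: z0.
  by rewrite -natr1; exact: (seqT_binom IH).
rewrite NegzE mulrNz -pmulrn; elim: m.+1 => [|k IH]; first by rewrite oppr0; exact: z0.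
by rewrite -natr1 opprD; exact: (seqTinv_binom IH).
Qed.

Definition chi (k : nat) (x : circle R) (phi : calH R) : R[i]^o := cval (calH_seq phi k x).

Lemma continuous_chi k x : continuous (chi k x).
Proof.
apply/continuous_circleP; move: x; apply/continuous_HomP.
exact: calH_seq_continuous.
Qed.

Lemma omega_chi k x t : cval x = expi (2 * pi * t) ->
  omega (T_homeo R) (zero_tilde R) (chi k x) = poly_phase (t *: binomp k).
Proof.
move=> xt; apply/funext => n; rewrite /omega /chi (orbit_binom n k xt).
by rewrite /poly_phase (hornerZ t) mulrA.
Qed.

Lemma poly_phaseD p q : poly_phase (p + q) = poly_phase p * poly_phase q.
Proof. by apply/funext => n; rewrite /poly_phase hornerD mulrDr expiD. Qed.

(* Descending on the degree, [p] is written as a sum of terms [c *: binomp k], and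
   [chi k (e^(2 pi i c))] realises such a term. *)
Lemma poly_phase_omega p : exists2 f, Cfun R (calH R) f &
  omega (T_homeo R) (zero_tilde R) f = poly_phase p.
Proof.
have [m] := ubnP (size p); elim: m p => // m IH p; rewrite ltnS => szp.
case: m => [|m] in IH szp *.
  exists (fun=> 1); first exact: cst_continuous.
  move: szp; rewrite leqn0 size_poly_eq0 => /eqP ->; apply/funext => n.
  by rewrite /omega /poly_phase horner0 mulr0 expi0.
(* This multiple of [binomp m] cancels the coefficient of [p] in degree [m]. That coefficient may be
   zero, since the size of [p] is only bounded above. *)
pose c := p`_m / (binomp m)`_m.
have [|f cf fE] := IH (p - c *: binomp m).
  rewrite ltnS; apply/leq_sizeP => j; rewrite leq_eqVlt => /orP[/eqP <-|mj].
    rewrite coefB coefZ divfK ?subrr //.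
    have := lead_coef_eq0 (binomp m).
    by rewrite lead_coefE -size_poly_eq0 !size_binomp => ->.
  by rewrite coefB coefZ !nth_default ?mulr0 ?subr0 // ?size_binomp // (leq_trans szp).
have nx : `|expi (2 * pi * c)| = 1 := norm_expi _.
exists (fun phi => f phi * chi m (mkcircle nx) phi).
  by apply: continuous_mulc; [exact: cf|exact: continuous_chi].
rewrite -(subrK (c *: binomp m) p) poly_phaseD -fE.
by rewrite -(@omega_chi m (mkcircle nx)).
Qed.

End Orbit.

(** * The Weyl algebra *)

Section WeylAlgebra.
Variable R : realType.
Implicit Types (u v w : int -> R[i]^o) (V : set (int -> R[i]^o)).
Local Open Scope complex_scope.

Lemma closed_uniformP V : closed (V : set {uniform int -> R[i]^o}) <->
  forall u, (forall e : R, 0 < e -> exists2 v, V v & forall n, `|u n - v n| <= e%:C) ->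
    V u.
Proof.
split=> [clV u uV|VP u clu].
  apply: clV => B /uniform_nbhs[E []]; rewrite -entourage_ballE => -[eps /=].
  move=> /complex_gt0[e e0 ->] eE EB; have [|v Vv uv] := uV (e / 2); first by rewrite divr_gt0.
  exists v; split=> //; apply: EB => n _; apply: eE; rewrite /= -ball_normE /=.
  by rewrite (le_lt_trans (uv n)) // ltcR ltr_pdivrMr // mulr_natr mulr2n ltrDl.
apply: VP => e e0.
have [|v [Vv uv]] := clu [set v | forall n, `|u n - v n| <= e%:C].
  apply/uniform_nbhs; exists [set xy | ball xy.1 (e%:C : R[i]) xy.2]; split.
    by rewrite -entourage_ballE; exists e%:C => //=; rewrite ltcR.
  by move=> v uv n; have := uv n I; rewrite /= -ball_normE /= => /ltW.
by exists v.
Qed.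

Lemma linftyP u : linfty u -> exists2 M : R, 0 < M & forall n, `|u n| <= M%:C.
Proof.
move=> [M uM]; have : M \is Num.real by rewrite ger0_real // (le_trans _ (uM 0)).
move=> /complex_realP[m mE]; exists (`|m| + 1); first by rewrite ltr_wpDl.
move=> n; rewrite (le_trans (uM n)) // mE lecR (le_trans (ler_norm m)) //.
by rewrite lerDl.
Qed.

Lemma linfty_subspace : closed_subspace_linfty (@linfty R).
Proof.
split=> //; first by exists 0 => n; rewrite normr0.
- move=> a u v [M uM] [N vN]; exists (`|a| * M + N) => n.
  by rewrite (le_trans (ler_normD _ _)) // lerD // normrM ler_wpM2l.
- apply/closed_uniformP => u uV; have [v [M vM] uv] := uV 1 ltr01.
  exists (1%:C + M) => n; rewrite -[u n](subrK (v n)).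
  by rewrite (le_trans (ler_normD _ _)) // lerD.
Qed.

Lemma linfty_poly_phase p : linfty (@poly_phase R p).
Proof. by exists 1 => n; rewrite norm_expi. Qed.

(** Linearity and closedness pass to intersections; boundedness holds because [linfty] is itself one
    of the subspaces intersected. *)
Lemma Weyl_subspace : closed_subspace_linfty (Weyl R).
Proof.
have Wlinf : Weyl R `<=` @linfty R.
  apply: smallest_sub; first exact: linfty_subspace.
  by move=> _ [p _ <-]; exact: linfty_poly_phase.
split=> //.
- by move=> V [[_ V0 _ _] _].
- by move=> a u v Wu Wv V VP; case: (VP) => -[_ _ VL _] _; apply: VL; [exact: Wu|exact: Wv].
- apply: closed_bigI => V [[_ _ _ Vcl] _]; exact: Vcl.
Qed.

Lemma Weyl_poly_phase p : Weyl R (poly_phase p).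
Proof. by move=> V [_]; apply; exists p. Qed.

Lemma Weyl_sub V : closed_subspace_linfty V -> (forall p, V (@poly_phase R p)) ->
  Weyl R `<=` V.
Proof. by move=> CV Vp; apply: smallest_sub => // _ [p _ <-]. Qed.

Lemma WeylL (a : R[i]) u v : Weyl R u -> Weyl R v -> Weyl R (a *: u + v).
Proof. by case: Weyl_subspace => _ _ + _; apply. Qed.

Lemma Weyl0 : Weyl R 0. Proof. by case: Weyl_subspace. Qed.

Lemma WeylZ (a : R[i]) u : Weyl R u -> Weyl R (a *: u).
Proof. by move=> Wu; rewrite -[_ *: _]addr0; apply: WeylL => //; exact: Weyl0. Qed.

Lemma WeylD u v : Weyl R u -> Weyl R v -> Weyl R (u + v).
Proof. by move=> Wu Wv; rewrite -[u]scale1r; exact: WeylL. Qed.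

Lemma Weyl_cst (a : R[i]) : Weyl R (fun=> a).
Proof.
rewrite (_ : (fun _ => _) = a *: poly_phase 0).
  by apply: WeylZ; exact: Weyl_poly_phase.
apply/funext => n; rewrite -[LHS]mulr1; congr (a * _).
by rewrite /poly_phase horner0 mulr0 expi0.
Qed.

Lemma Weyl_closed u :
  (forall e : R, 0 < e -> exists2 v, Weyl R v & forall n, `|u n - v n| <= e%:C) ->
  Weyl R u.
Proof. by have [_ _ _ /closed_uniformP] := Weyl_subspace; apply. Qed.

(** Multiplication by a bounded [w] is linear and continuous for the sup norm, so it pulls [Weyl]
    back to a closed subspace. Boundedness of [u] is demanded as well because [u * w] does not
    control [u] where [w] vanishes. *)
Lemma Weyl_multiplier_subspace w : linfty w ->
  closed_subspace_linfty [set u | linfty u /\ Weyl R (u * w)].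
Proof.
move=> /linftyP[M M0 wM]; have [_ l0 lL /closed_uniformP lcl] := linfty_subspace.
split=> [u [] //||a u v [lu Wu] [lv Wv]|].
- by split=> //; rewrite mul0r; exact: Weyl0.
- split; first exact: lL.
  rewrite (_ : _ * w = a *: (u * w) + v * w); first exact: WeylL.
  by apply/funext => n; rewrite [LHS]mulrDl; congr (_ + _); exact/esym/mulrA.
- apply/closed_uniformP => u uV; split.
    by apply: lcl => e /uV[v [lv _] uv]; exists v.
  apply: Weyl_closed => e e0; have [|v [_ Wv] uv] := uV (e / M); first by rewrite divr_gt0.
  exists (v * w) => // n; rewrite -[_ - _]mulrBl normrM.
  rewrite (le_trans (ler_pM _ _ (uv n) (wM n))) //.
  by rewrite -rmorphM /= divfK // gt_eqF.
Qed.

(** Minimality of [Weyl] is used twice: first with a phase as multiplier, since a product of phases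
    is a phase, then with an arbitrary multiplier in [Weyl], the first round covering the
    generators. *)
Lemma WeylM u v : Weyl R u -> Weyl R v -> Weyl R (u * v).
Proof.
have lW w : Weyl R w -> linfty w by case: Weyl_subspace => + _ _ _; apply.
have WMp w p : Weyl R w -> Weyl R (w * poly_phase p).
  move=> Ww; suff [] : linfty w /\ Weyl R (w * poly_phase p) by [].
  apply: (Weyl_sub (Weyl_multiplier_subspace (linfty_poly_phase p))) Ww => q.
  split; first exact: linfty_poly_phase.
  by rewrite -poly_phaseD; exact: Weyl_poly_phase.
move=> Wu Wv; suff [] : linfty u /\ Weyl R (u * v) by [].
apply: (Weyl_sub (Weyl_multiplier_subspace (lW _ Wv))) Wu => q.
split; first exact: linfty_poly_phase.
by rewrite mulrC; exact: WMp.
Qed.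

(** Conjugation is isometric and conjugate-linear and sends the phase of [p] to that of [- p], so
    the condition defines a closed subspace containing the generators. *)
Lemma Weyl_conj u : Weyl R u -> Weyl R (fun n => (u n)^*%C).
Proof.
have [Wl _ _ _] := Weyl_subspace.
apply: (@Weyl_sub [set u | Weyl R (fun n => (u n)^*%C)]).
  split.
  - by move=> v /Wl[M vM]; exists M => n; rewrite -normcJ.
  - rewrite /= (_ : (fun _ => _) = 0); first exact: Weyl0.
    by apply/funext => n; exact: conjc0.
  - move=> a v w /= Wv Ww.
    rewrite (_ : (fun _ => _) = a^*%C *: (fun n => (v n)^*%C) + (fun n => (w n)^*%C)).
      exact: WeylL.
    by apply/funext => n; rewrite rmorphD /= rmorphM.
  - apply/closed_uniformP => v vV; apply: Weyl_closed => e /vV[w Ww vw].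
    by exists (fun n => (w n)^*%C) => // n; rewrite -rmorphB /= normcJ.
move=> p /=; rewrite (_ : (fun _ => _) = poly_phase (- p)); first exact: Weyl_poly_phase.
by apply/funext => n; rewrite /poly_phase hornerN mulrN; exact: expi_conj.
Qed.

End WeylAlgebra.

(** * The two inclusions between the image of [omega] and [Weyl] *)

Section Main.
Variable R : realType.
Local Open Scope complex_scope.
Let om := @omega R (calH R) (T_homeo R) (zero_tilde R).

Lemma Weyl_chi k x : Weyl R (om (chi k x)).
Proof.
have [t _ tx] := expi_surj (cvalP x).
have pi20 : 2 * pi != 0 :> R by rewrite mulf_neq0 // gt_eqF // pi_gt0.
have xt : cval x = expi (2 * pi * (t / (2 * pi))) by rewrite mulrC divfK.
by rewrite /om (omega_chi k xt); exact: Weyl_poly_phase.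
Qed.

Lemma omega_Weyl f : Cfun R (calH R) f -> Weyl R (om f).
Proof.
move=> cf.
move: f cf; apply: (@complex_stone_weierstrass R (calH R) [set f | Weyl R (om f)]).
- exact: compact_calH.
- exact: Weyl_cst.
- by move=> f g; exact: WeylD.
- by move=> f g; exact: WeylM.
- by move=> f; exact: Weyl_conj.
- move=> f fapp; apply: Weyl_closed => e /fapp[g Wg fg].
  by exists (om g) => // n; exact: fg.
- move=> x y xy; apply: contrapT => /forallNP nchi; apply: xy; apply: val_inj.
  apply/funext => k; apply: hom_ext => z; apply: cval_inj; apply: contrapT => xyz.
  by apply: (nchi (chi k z)); split=> //; [exact: Weyl_chi|exact: continuous_chi].
Qed.

Lemma omega_image_subspace : closed_subspace_linfty (om @` Cfun R (calH R)).
Proof.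
split.
- move=> _ [f cf <-].
  have [M _ fM] := compact_fun_bounded (@compact_calH R) (continuous_Re_comp cf).
  have [N _ fN] := compact_fun_bounded (@compact_calH R) (continuous_Im_comp cf).
  exists (M + N)%:C => n; rewrite (le_trans (normc_le_add _)) // lecR lerD //.
    exact: fM.
  exact: fN.
- by exists (fun=> 0) => //; exact: cst_continuous.
- move=> a _ _ [f cf <-] [g cg <-].
  exists (fun x => a * f x + g x); last by apply/funext => n.
  apply: continuous_addc; last exact: cg.
  by apply: continuous_mulc; [exact: cst_continuous|exact: cf].
- apply/closed_uniformP => u uV.
  (* The extension result is about real functions, so the real and imaginary parts of the uniform
     limit are extended separately. *)
  have [|F cF FE] := @uniformly_closed_restriction R (calH R) int
      (fun n => homeo_iter (T_homeo R) n (zero_tilde R)) (fun n => Re (u n)).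
    move=> d /uV[_ [f cf <-] uf]; exists (fun x => Re (f x)); first exact: continuous_Re_comp.
    by move=> n; rewrite -lecR (le_trans _ (uf n)) // -raddfB normc_ge_Re.
  have [|G cG GE] := @uniformly_closed_restriction R (calH R) int
      (fun n => homeo_iter (T_homeo R) n (zero_tilde R)) (fun n => Im (u n)).
    move=> d /uV[_ [f cf <-] uf]; exists (fun x => Im (f x)); first exact: continuous_Im_comp.
    by move=> n; rewrite -lecR (le_trans _ (uf n)) // -raddfB normc_ge_Im.
  exists (fun x => F x +i* G x); first exact: continuous_complex.
  by apply/funext => n; rewrite /om /omega FE GE; case: (u n).
Qed.

End Main.

Theorem theorem4p7 (R : realType) :
  [set omega (T_homeo R) (zero_tilde R) f | f in Cfun R (calH R)] = Weyl R.
Proof.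
apply/seteqP; split=> [_ [f cf <-]|]; first exact: omega_Weyl.
apply: Weyl_sub; first exact: omega_image_subspace.
by move=> p; have [f cf fE] := poly_phase_omega p; exists f.
Qed.
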